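(* Let $X$ be a real Hilbert space and $A:X\to 2^X$ a maximally monotone operator with at least one zero. Consider the Algorithm described in the context with any initialization, where $\nu\in[0,\infty)$ is allowed to be an arbitrary nonnegative number. Then there exist sequences which satisfy the Algorithm in the exact and inexact cases. More precisely, given $n\in\mathbb{N}\cup\{0\}$ and $x_n\in X$, at least one of the following possibilities holds: (i) $x_n$ is a zero of $A$ (i.e. $0\in Ax_n$). In this case $(y_n,\eta_n):=(x_n,0)$ satisfies the system (S) of the Algorithm. (ii) $\nu=0$. In this case there exists a unique pair $(\eta_n,y_n)\in Z\times X$ such that (S) holds, namely $y_n=(I+\lambda_nA)^{-1}(x_n)$, $\eta_n=0$. (iii) $x_n$ is not a zero of $A$ and $\nu>0$. In this case there exists $r_n>0$ such that for each $\eta_n\in Z$ satisfying $\|\eta_n\|<r_n$ there exists a unique $y_n\in X$ such that (S) holds. Furthermore, $$y_n=(I+\lambda_nA)^{-1}(x_n+\eta_n).$$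
   Context: $A:X\to 2^X$ is monotone if $\langle x_1^*-x_2^*,x_1-x_2\rangle\ge 0$ whenever $x_1^*\in Ax_1$, $x_2^*\in Ax_2$, and maximally monotone if its graph is not properly contained in the graph of another monotone operator. $I$ is the identity; $(I+\lambda A)^{-1}(w)=\{x:w\in x+\lambda Ax\}$, which for maximally monotone $A$ and $\lambda>0$ is a singleton, identified with its element. Algorithm. Initialization: choose $x_0\in X$, a sequence of positive numbers $(\lambda_n)_{n=0}^\infty$ with $\widehat{\lambda}:=\inf\{\lambda_n:n\in\mathbb{N}\}>0$, a linear subspace $Z$ of $X$, and a number $\nu\in[0,\infty)$. (In the original version of the algorithm, one has $\nu=\left(\sqrt{\sigma+(1-\sigma)t^2}-t\right)/(1+t)$ with $t=2\rho/\widehat{\lambda}$, $\sigma\in[0,1)$ and $\rho\in(0,\widehat{\lambda}/2)$; here $\nu$ may be any nonnegative number.) Iterative step: given $n\in\mathbb{N}\cup\{0\}$ and $x_n\in X$, find $y_n\in X$ and $\eta_n\in X$ satisfying $$\text{(S)}\qquad \eta_n\in(\lambda_nA(y_n)+y_n-x_n)\cap Z,\qquad \|\eta_n\|\le\nu\|y_n-x_n\|,$$ and define $x_{n+1}:=y_n-\eta_n$. ''Exact'' refers to $\eta_n=0$ and ''inexact'' to $\eta_n\ne 0$. *)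

(* Defs.v *)
From HB Require Import structures.
From mathcomp Require Import all_boot all_order all_algebra.
From mathcomp Require Import all_classical all_reals all_analysis.
Import Order.TTheory GRing.Theory Num.Theory.
Import numFieldNormedType.Exports.

Set Implicit Arguments.
Unset Strict Implicit.
Unset Printing Implicit Defensive.

Local Open Scope classical_set_scope.
Local Open Scope ring_scope.

(* A real Hilbert space is a complete normed module [X] over a [realType],
   together with a symmetric positive definite bilinear form
   [dot : {dot X for idfun}] inducing its norm. *)
Definition induces_norm (R : realType) (X : completeNormedModType R)
    (dot : {dot X for idfun}) : Prop :=
  forall x : X, dot x x = `|x| ^+ 2.

Definition graph (X : Type) (A : X -> set X) : set (X * X) :=
  [set p | A p.1 p.2].

Definition monotone (R : realType) (X : completeNormedModType R)
    (dot : {dot X for idfun}) (A : X -> set X) : Prop :=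
  forall x1 x2 u1 u2 : X, A x1 u1 -> A x2 u2 -> 0 <= dot (u1 - u2) (x1 - x2).

Definition maximally_monotone (R : realType) (X : completeNormedModType R)
    (dot : {dot X for idfun}) (A : X -> set X) : Prop :=
  monotone dot A /\
  forall B : X -> set X, monotone dot B -> ~ (graph A `<` graph B).

Definition is_zero (R : realType) (X : completeNormedModType R)
    (A : X -> set X) (x : X) : Prop := A x 0.

(* [(I + lam A)^-1 (w)] as a set; that it is a single point [y] is expressed by
   [resolvent A lam w = [set y]]. *)
Definition resolvent (R : realType) (X : completeNormedModType R)
    (A : X -> set X) (lam : R) (w : X) : set X :=
  [set x | [set x + lam *: u | u in A x] w].

Definition stepS (R : realType) (X : completeNormedModType R)
    (A : X -> set X) (Z : set X) (nu lam : R) (x y eta : X) : Prop :=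
  ([set lam *: u + y - x | u in A y] `&` Z) eta /\ `|eta| <= nu * `|y - x|.

Definition satisfies_algorithm (R : realType) (X : completeNormedModType R)
    (A : X -> set X) (Z : set X) (nu : R) (lam : nat -> R) (x0 : X)
    (x y eta : nat -> X) : Prop :=
  x 0%N = x0 /\
  forall n : nat,
    stepS A Z nu (lam n) (x n) (y n) (eta n) /\ x n.+1 = y n - eta n.

(* Main.v *)
Require Import Defs.
From HB Require Import structures.
From mathcomp Require Import all_boot all_order all_algebra.
From mathcomp Require Import all_classical all_reals all_analysis.
From mathcomp Require Import ring lra.
Import Order.TTheory GRing.Theory Num.Theory.
Import numFieldNormedType.Exports.
Local Open Scope classical_set_scope.
Local Open Scope ring_scope.

(* Everything rests on Minty's theorem: [I + lam A] is onto.  Translating and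
   scaling, it is enough to find [x] with [- x \in A x].  The Fitzpatrick
   function [F (x, u) = sup_(v \in A a) (<x, v> + <a, u> - <a, v>)] is convex,
   lower semicontinuous, equals [<x, u>] on the graph of [A] and dominates
   [<x, u>] everywhere by maximality.  The strongly convex function
   [F (x, u) + (|x|^2 + |u|^2) / 2] has a minimiser [(x, u)] because minimising
   sequences are Cauchy.  First-order optimality against the points of the graph
   shows that [(- u, - x)] is monotonically related to the graph, so belongs to
   it, and optimality against that very point forces [u = - x]. *)

(** * Inner product and convergence *)

Section DotProduct.
Context {R : realType} {X : completeNormedModType R}.
Variable dot : {dot X for idfun}.
Implicit Types (x y z v : X) (w : nat -> X).

Lemma dotC x y : dot x y = dot y x.
Proof. by rewrite hermC expr0 mul1r. Qed.

Lemma dotDl x y z : dot (x + y) z = dot x z + dot y z.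
Proof. exact: linearDl. Qed.

Lemma dotNl x y : dot (- x) y = - dot x y.
Proof. exact: linearNl. Qed.

Lemma dotZl a x y : dot (a *: x) y = a * dot x y.
Proof. exact: linearZl_LR. Qed.

Lemma dotDr x y z : dot x (y + z) = dot x y + dot x z.
Proof. exact: linearDr. Qed.

Lemma dotNr x y : dot x (- y) = - dot x y.
Proof. exact: linearNr. Qed.

Lemma dotZr a x y : dot x (a *: y) = a * dot x y.
Proof. by rewrite linearZr_LR. Qed.

Definition dotE := (dotDl, dotNl, dotZl, dotDr, dotNr, dotZr).

Hypothesis hdot : induces_norm dot.

Lemma dot_ge0 x : 0 <= dot x x.
Proof. by rewrite hdot sqr_ge0. Qed.

Lemma dot_le0_eq0 x : dot x x <= 0 -> x = 0.
Proof.
rewrite hdot => x0; apply/eqP.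
by rewrite -normr_eq0 -sqrf_eq0 eq_le x0 sqr_ge0.
Qed.

Lemma cvg_dotxx w x :
  w @ \oo --> x -> dot (w n) (w n) @[n --> \oo] --> dot x x.
Proof.
move=> wx; rewrite hdot; under eq_fun do rewrite hdot.
by apply: cvgM; exact: cvg_norm.
Qed.

(** Polarization reduces this to the convergence of squared norms. *)
Lemma cvg_dotl w x v :
  w @ \oo --> x -> dot (w n) v @[n --> \oo] --> dot x v.
Proof.
have polar y : dot y v = (dot (y + v) (y + v) - dot y y - dot v v) / 2.
  by rewrite !dotE (dotC v y); lra.
move=> wx; rewrite polar; under eq_fun do rewrite polar.
apply: cvgM; last exact: cvg_cst.
apply: cvgB; last exact: cvg_cst.
by apply: cvgB; apply: cvg_dotxx => //; apply: cvgD => //; exact: cvg_cst.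
Qed.

(** Meant for minimising sequences whose gap to the infimum is below [harmonic n]. *)
Lemma cvg_of_harmonic_cauchy w (c : R) :
  (forall n m, dot (w n - w m) (w n - w m) <= c * (harmonic n + harmonic m)) ->
  cvg (w @ \oo).
Proof.
move=> wC; apply: cauchy_cvg; apply: cauchy_exP => e e0.
have h0 : c * (harmonic n + harmonic n) @[n --> \oo] --> 0.
  rewrite -(mulr0 c) -(addr0 0).
  by apply: cvgM; [exact: cvg_cst|apply: cvgD; exact: cvg_harmonic].
have [N _ hN] := cvgr_lt 0 h0 (e ^+ 2) (exprn_gt0 2 e0).
have h0' : c * (harmonic N + harmonic n) @[n --> \oo] --> c * (harmonic N + 0).
  apply: cvgM; first exact: cvg_cst.
  by apply: cvgD; [exact: cvg_cst|exact: cvg_harmonic].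
(* The sign of [c] is not given, but [wC N N] makes [c * (harmonic N + harmonic N)] nonnegative, so
   its half stays below [e ^+ 2]. *)
have h1 : c * (harmonic N + 0) < e ^+ 2.
  have : c * (harmonic N + harmonic N) < e ^+ 2 := hN N (leqnn N).
  have : 0 <= c * (harmonic N + harmonic N).
    by apply: le_trans (wC N N); exact: dot_ge0.
  by rewrite addr0 mulrDr; lra.
exists (w N).
apply: filterS (cvgr_lt _ h0' _ h1) => n hn.
rewrite -ball_normE /ball_ /= -(ltr_pXn2r (n := 2)) ?nnegrE ?normr_ge0 ?(ltW e0) //.
by rewrite -hdot; exact: le_lt_trans (wC N n) hn.
Qed.

End DotProduct.

Arguments dot_ge0 {R X dot}.
Arguments dot_le0_eq0 {R X dot}.
Arguments cvg_of_harmonic_cauchy {R X dot}.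

(** * Minimising the regularized Fitzpatrick function *)

Section Fitzpatrick.
Context {R : realType} {X : completeNormedModType R}.
Variable dot : {dot X for idfun}.
Hypothesis hdot : induces_norm dot.
Variable A : X -> set X.

(* The epigraph of the Fitzpatrick function, which itself may take the value
   [+oo]. *)
Definition fitzpatrick_epi (x u : X) (t : R) : Prop :=
  forall a v, A a v -> dot x v + dot a u - dot a v <= t.

(** Minimising this over the epigraph, [t] included, amounts to minimising the Fitzpatrick function
    plus half the squared norms, with finite values only. *)
Definition regularized (x u : X) (t : R) : R := t + (dot x x + dot u u) / 2.

(** The epigraph is cut out by inequalities that are affine in [(x, u, t)]. *)
Lemma fitzpatrick_epi_convex {s : R} {x u t x' u' t'} : 0 <= s <= 1 ->
  fitzpatrick_epi x u t -> fitzpatrick_epi x' u' t' ->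
  fitzpatrick_epi (x + s *: (x' - x)) (u + s *: (u' - u)) (t + s * (t' - t)).
Proof.
move=> /andP[s0 s1] h h' a v Aav; rewrite !dotE.
move: (h _ _ Aav) (h' _ _ Aav); nra.
Qed.

Lemma fitzpatrick_epi_closed {x u : nat -> X} {t : nat -> R} {x' u' t'} :
  (forall n, fitzpatrick_epi (x n) (u n) (t n)) ->
  x @ \oo --> x' -> u @ \oo --> u' -> t @ \oo --> t' ->
  fitzpatrick_epi x' u' t'.
Proof.
move=> h cx cu ct a v Aav; rewrite -subr_le0.
have c : dot (x n) v + dot (u n) a - dot a v - t n @[n --> \oo] -->
    dot x' v + dot u' a - dot a v - t'.
  apply: cvgB => //; apply: cvgB; last exact: cvg_cst.
  by apply: cvgD; exact: cvg_dotl.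
rewrite (dotC dot a u'); apply: cvgr_to_le c _.
by near=> n; rewrite (dotC dot (u n)) subr_le0; exact: h.
Unshelve. all: by end_near.
Qed.

(** Monotonicity rearranged: on the graph the Fitzpatrick function is at most the inner product. *)
Lemma fitzpatrick_epi_graph {a v} :
  Defs.monotone dot A -> A a v -> fitzpatrick_epi a v (dot a v).
Proof.
move=> mA Aav b w Abw; have := mA _ _ _ _ Aav Abw.
by rewrite !dotE (dotC dot v a) (dotC dot v b) (dotC dot w a) (dotC dot w b); lra.
Qed.

Lemma exists_regularized_min : Defs.monotone dot A -> (exists a v, A a v) ->
  exists x u t, fitzpatrick_epi x u t /\
    forall x' u' t', fitzpatrick_epi x' u' t' ->
      regularized x u t <= regularized x' u' t'.
Proof.
move=> mA [a [v Aav]].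
pose S := [set r : R | exists x u t, fitzpatrick_epi x u t /\ r = regularized x u t].
have infS : has_inf S.
  split; first by exists (regularized a v (dot a v)), a, v, (dot a v);
    split => //; exact: fitzpatrick_epi_graph.
  (* Lower bound: test the epigraph at [(a, v)] and expand the squares of [x + v] and [a + u]. *)
  exists (- (dot a v + (dot a a + dot v v) / 2)) => _ [x [u [t [h ->]]]].
  have := h _ _ Aav; have := dot_ge0 hdot (x + v); have := dot_ge0 hdot (a + u).
  by rewrite /regularized !dotE (dotC dot v x) (dotC dot u a); lra.
have leS x u t : fitzpatrick_epi x u t -> inf S <= regularized x u t.
  by move=> h; apply: ge_inf; [exact: infS.2|exists x, u, t].
have /choice[p hp] (n : nat) : exists p : X * X * R,
    fitzpatrick_epi p.1.1 p.1.2 p.2 /\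
    regularized p.1.1 p.1.2 p.2 < inf S + harmonic n.
  have [|_ [x [u [t [h ->]]]] lt] := @inf_adherent _ S (harmonic n) _ infS.
    by rewrite /= invr_gt0.
  by exists (x, u, t).
pose x n := (p n).1.1; pose u n := (p n).1.2.
have bound n m : dot (x n - x m) (x n - x m) + dot (u n - u m) (u n - u m) <=
    4 * (harmonic n + harmonic m).
  have [hn ln] := hp n; have [hm lm] := hp m.
  have half : 0 <= (2^-1 : R) <= 1 by lra.
  (* By the parallelogram law, the value at the midpoint is the average of the two values minus one
     eighth of the left-hand side; it is still at least [inf S], whence the factor 4. *)
  have := leS _ _ _ (fitzpatrick_epi_convex half hn hm).
  move: (harmonic n) (harmonic m) ln lm => rn rm; rewrite /regularized /x /u.
  case: (p n) => [[xn un] tn] /=; case: (p m) => [[xm um] tm] /=.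
  rewrite !dotE (dotC dot xm xn) (dotC dot um un).
  by lra.
have cx : cvg (x @ \oo).
  apply: (cvg_of_harmonic_cauchy hdot _ 4) => n m.
  by apply: le_trans (bound n m); rewrite lerDl dot_ge0.
have cu : cvg (u @ \oo).
  apply: (cvg_of_harmonic_cauchy hdot _ 4) => n m.
  by apply: le_trans (bound n m); rewrite lerDr dot_ge0.
set x' := lim (x @ \oo) in cx; set u' := lim (u @ \oo) in cu.
(* The heights in [p] need not visibly converge. They are raised to the bound given by [hp], which
   stays in the epigraph and converges along with [x] and [u]. *)
pose t n := inf S + harmonic n - (dot (x n) (x n) + dot (u n) (u n)) / 2.
pose t' := inf S - (dot x' x' + dot u' u') / 2.
exists x', u', t'; split; last first.
  by move=> x'' u'' t'' /leS; apply: le_trans; rewrite /regularized /t' subrK.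
apply: (@fitzpatrick_epi_closed x u t) => //.
  move=> n b w /((hp n).1 b w); have := (hp n).2.
  by rewrite /regularized /t /x /u; lra.
rewrite /t' -{1}(addr0 (inf S)); apply: cvgB.
  by apply: cvgD; [exact: cvg_cst|exact: cvg_harmonic].
apply: cvgM; last exact: cvg_cst.
by apply: cvgD; exact: cvg_dotxx.
Qed.

Lemma exists_opposite_in_graph : Defs.monotone dot A -> (exists a v, A a v) ->
  (forall x u, (forall a v, A a v -> 0 <= dot (u - v) (x - a)) -> A x u) ->
  exists x, A x (- x).
Proof.
move=> mA neA maxA.
have [x [u [t [h hmin]]]] := exists_regularized_min mA neA.
(* Otherwise [(x, u)] would be monotonically related to the graph, hence in it, and testing [h]
   there would give the inequality after all. *)
have xu_t : dot x u <= t.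
  rewrite leNgt; apply/negP => txu.
  have Axu : A x u.
    apply: maxA => a v Aav; have := h _ _ Aav.
    by rewrite !dotE (dotC dot u x) (dotC dot u a) (dotC dot v x) (dotC dot v a); lra.
  by have := h _ _ Axu; lra.
(* The right-hand side [c] is the derivative at [s = 0] of [regularized] along the segment from the
   minimiser to [(a, v, dot a v)]; [q] is the coefficient of [s ^+ 2]. *)
have var a v : A a v ->
    0 <= dot a v - t + dot x (a - x) + dot u (v - u).
  move=> Aav; set c := (X in 0 <= X).
  set q := (dot (a - x) (a - x) + dot (v - u) (v - u)) / 2.
  have cq s : 0 < s <= 1 -> 0 <= c + s * q.
    move=> /andP[s0 s1].
    have s01 : 0 <= s <= 1 by rewrite s1 ltW.
    have := hmin _ _ _
      (fitzpatrick_epi_convex s01 h (fitzpatrick_epi_graph mA Aav)).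
    have -> : regularized (x + s *: (a - x)) (u + s *: (v - u))
      (t + s * (dot a v - t)) = regularized x u t + s * (c + s * q).
      rewrite /regularized /c /q !dotE (dotC dot a x) (dotC dot v u).
      by field.
    by rewrite lerDl pmulr_rge0.
  rewrite leNgt; apply/negP => c0.
  have q0 : 0 <= q by rewrite divr_ge0 // addr_ge0 // dot_ge0.
  (* If [c < 0], this step length makes [c + s * q] equal to [c * (1 - c) / (q - c + 1)], which is
     negative. *)
  have s0 : 0 < - c / (q - c + 1) <= 1.
    rewrite divr_gt0 /=; [|lra|lra].
    by rewrite ler_pdivrMr; lra.
  have := cq _ s0.
  have -> : c + - c / (q - c + 1) * q = c * (1 - c) / (q - c + 1).
    by field; lra.
  rewrite pmulr_lge0 ?invr_gt0; [nra|lra].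
(* With [xu_t], [var] bounds [dot (x + v) (u + a)] below by [dot (x + u) (x + u)]. *)
have Aux : A (- u) (- x).
  apply: maxA => a v Aav; have := var _ _ Aav.
  have := dot_ge0 hdot (x + u).
  rewrite !dotE (dotC dot u x) (dotC dot v u) (dotC dot v a).
  by lra.
(* At the point [(- u, - x)], [var] and [xu_t] give [dot (x + u) (x + u) <= 0]. *)
have xuE : x + u = 0.
  apply: (dot_le0_eq0 hdot); have := var _ _ Aux.
  by rewrite !dotE (dotC dot u x); lra.
have {}xuE : x = - u by apply/eqP; rewrite -addr_eq0 xuE.
by exists x; rewrite {1}xuE.
Qed.

End Fitzpatrick.

(** * Resolvents of a maximally monotone operator *)

Section Resolvent.
Context {R : realType} {X : completeNormedModType R}.
Variable dot : {dot X for idfun}.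
Hypothesis hdot : induces_norm dot.
Variable A : X -> set X.

(** Adjoining [(x, u)] to the graph keeps it monotone, so by maximality the point is not new. *)
Lemma maximally_monotone_mem x u : maximally_monotone dot A ->
  (forall a v, A a v -> 0 <= dot (u - v) (x - a)) -> A x u.
Proof.
move=> [mA maxA] xu; apply: contrapT => nAxu.
apply: (maxA (fun a v => A a v \/ a = x /\ v = u)).
  move=> x1 x2 u1 u2 [A1|[-> ->]] [A2|[-> ->]].
  - exact: mA.
  - by rewrite -opprB -(opprB x) dotNl dotNr opprK; exact: xu.
  - exact: xu.
  - by rewrite !subrr dot_ge0.
split; first by move=> [a v]; left.
by move=> /(_ (x, u)) /= h; apply/nAxu/h; right.
Qed.

Hypothesis hA : maximally_monotone dot A.

(** The square of [w - w'] expands to that of [y - y'], a cross term that is nonnegative by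
    monotonicity, and a square. *)
Lemma resolvent_nonexpansive (lam : R) w w' y y' : 0 < lam ->
  resolvent A lam w y -> resolvent A lam w' y' -> `|y - y'| <= `|w - w'|.
Proof.
move=> lam0 [u Au <-] [u' Au' <-].
rewrite -(ler_pXn2r (n := 2)) ?nnegrE ?normr_ge0 // -!hdot.
have := hA.1 _ _ _ _ Au Au'; rewrite opprD addrACA -scalerBr.
move: (u - u') (y - y') => {u u' y y' Au Au'} u y uy.
rewrite !dotE (dotC dot y u).
by have := dot_ge0 hdot u; nra.
Qed.

(** Minty's theorem: for [B = lam A - w], a point with [- x] in [B x] is one with [w] in
    [x + lam A x]. Both monotonicity and the maximality criterion pass from [A] to [B]. *)
Lemma resolvent_exists (lam : R) w : 0 < lam -> (exists a v, A a v) ->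
  exists y, resolvent A lam w y.
Proof.
move=> lam0 [a [v Aav]].
have lamK : lam * lam^-1 = 1 by rewrite divff // gt_eqF.
pose B x := [set lam *: u - w | u in A x].
have [|||x [u Axu xE]] := @exists_opposite_in_graph _ _ _ hdot B.
- move=> x1 x2 _ _ [u1 A1 <-] [u2 A2 <-].
  rewrite opprD addrACA subrr addr0 -scalerBr dotZl pmulr_rge0 //.
  exact: hA.1.
- by exists a, (lam *: v - w), v.
- move=> x u xu; exists (lam^-1 *: (u + w)); last first.
    by rewrite scalerA lamK scale1r addrK.
  apply: (maximally_monotone_mem _ _ hA) => b z Abz.
  rewrite -(pmulr_rge0 _ lam0) -dotZl scalerBr scalerA lamK scale1r.
  have -> : u + w - lam *: z = u - (lam *: z - w) by rewrite opprB addrA addrAC.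
  by apply: xu; exists z.
exists x; rewrite /resolvent /=; exists u => //.
by rewrite -(subrK w (lam *: u)) xE addrA subrr add0r.
Qed.

Lemma resolvent_unique (lam : R) w y y' : 0 < lam ->
  resolvent A lam w y -> resolvent A lam w y' -> y = y'.
Proof.
move=> lam0 wy wy'; apply/eqP.
rewrite -subr_eq0 -normr_le0 -(normr0 X) -(subrr w).
exact: resolvent_nonexpansive lam0 wy wy'.
Qed.

Lemma resolvent_set1 (lam : R) w y : 0 < lam ->
  resolvent A lam w y -> resolvent A lam w = [set y].
Proof.
move=> lam0 wy; apply/seteqP; split=> [y' wy' /=|_ -> //].
exact: resolvent_unique lam0 wy' wy.
Qed.

End Resolvent.

(** * The system (S) in terms of the resolvent *)

Section Step.
Context {R : realType} {X : completeNormedModType R}.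
Variables (A : X -> set X) (Z : set X).

Lemma stepSE (nu lam : R) x y eta : stepS A Z nu lam x y eta <->
  [/\ Z eta, resolvent A lam (x + eta) y & `|eta| <= nu * `|y - x|].
Proof.
split=> [[[[u Au <-] Zeta] le]|[Zeta [u Au ue] le]]; split => //.
  by exists u => //; rewrite (addrC x) subrK addrC.
by split => //; exists u => //; rewrite (addrC _ y) ue addrAC subrr add0r.
Qed.

Lemma resolvent_fixed (lam : R) x : 0 < lam ->
  resolvent A lam x x <-> is_zero A x.
Proof.
move=> lam0; split=> [[u Au /eqP]|Ax]; last by exists 0; rewrite ?scaler0 ?addr0.
rewrite -subr_eq0 addrAC subrr add0r scaler_eq0 gt_eqF //= => /eqP u0.
by rewrite /is_zero -u0.
Qed.

End Step.

(** * Existence of single steps and of whole runs *)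

Section Existence.
Context {R : realType} {X : completeNormedModType R}.
Variable dot : {dot X for idfun}.
Hypothesis hdot : induces_norm dot.
Variable A : X -> set X.
Hypothesis hA : maximally_monotone dot A.
Hypothesis hzero : exists z, is_zero A z.
Variable Z : set X.

Let graph_neq0 : exists a v, A a v.
Proof. by have [z Az] := hzero; exists z, 0. Qed.

Lemma exact_step (nu lam : R) x : 0 <= nu -> 0 < lam -> Z 0 ->
  exists2 y, resolvent A lam x y & stepS A Z nu lam x y 0.
Proof.
move=> nu0 lam0 Z0; have [y xy] := resolvent_exists _ hdot _ hA lam x lam0 graph_neq0.
by exists y => //; apply/stepSE; rewrite addr0 normr0; split => //; exact: mulr_ge0.
Qed.

(* By nonexpansiveness, [|y - x| >= |J x - x| - |eta|] for
   [J = (I + lam A)^-1] and [y = J (x + eta)]; hence the choice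
   [r = nu |J x - x| / (1 + nu)]. *)
Lemma inexact_step (nu lam : R) x : 0 < nu -> 0 < lam -> ~ is_zero A x ->
  exists2 r : R, 0 < r & forall eta, Z eta -> `|eta| < r ->
    exists2 y, resolvent A lam (x + eta) y & stepS A Z nu lam x y eta.
Proof.
move=> nu0 lam0 nAx.
have [j xj] := resolvent_exists _ hdot _ hA lam x lam0 graph_neq0.
have jx : 0 < `|j - x|.
  rewrite normr_gt0 subr_eq0; apply/eqP => jx; apply: nAx.
  by apply/(resolvent_fixed A lam x lam0); rewrite -{2}jx.
have nu1 : 0 < 1 + nu by rewrite addr_gt0.
exists (nu * `|j - x| / (1 + nu)); first by rewrite divr_gt0 // mulr_gt0.
move=> eta Zeta; rewrite ltr_pdivlMr // => etar.
have [y xy] := resolvent_exists _ hdot _ hA lam (x + eta) lam0 graph_neq0.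
exists y => //; apply/stepSE; split => //.
have := resolvent_nonexpansive _ hdot _ hA lam _ _ _ _ lam0 xj xy.
rewrite opprD addNKr normrN => jy.
have := ler_normD (j - y) (y - x); rewrite addrA subrK => tri.
by nra.
Qed.

Lemma stepS_unique (nu lam : R) x y eta : 0 < lam -> stepS A Z nu lam x y eta ->
  unique (fun y' => stepS A Z nu lam x y' eta) y.
Proof.
move=> lam0 Sy; split => // y' /stepSE[_ xy' _]; have /stepSE[_ xy _] := Sy.
exact: resolvent_unique _ hdot _ hA _ _ _ _ lam0 xy xy'.
Qed.

(** [P] carries the exactness or inexactness requirement. Choosing a step for all pairs [(n, x)] at
    once turns the run into a plain recursion. *)
Lemma algorithm_of_steps (nu : R) (lam : nat -> R) x0 (P : X -> X -> Prop) :
  (forall n x, exists y eta, stepS A Z nu (lam n) x y eta /\ P x eta) ->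
  exists x y eta : nat -> X,
    satisfies_algorithm A Z nu lam x0 x y eta /\ forall n, P (x n) (eta n).
Proof.
move=> step.
have /choice[f hf] (nx : nat * X) : exists q : X * X,
    stepS A Z nu (lam nx.1) nx.2 q.1 q.2 /\ P nx.2 q.2.
  by have [y [eta h]] := step nx.1 nx.2; exists (y, eta).
pose x := nat_rect (fun=> X) x0 (fun n xn => (f (n, xn)).1 - (f (n, xn)).2).
exists x, (fun n => (f (n, x n)).1), (fun n => (f (n, x n)).2).
by split=> [|n]; [split=> // n; split=> //|]; have [] := hf (n, x n).
Qed.

End Existence.

Theorem theorem10p2 (R : realType) (X : completeNormedModType R)
    (dot : {dot X for idfun}) (hdot : induces_norm dot)
    (A : X -> set X) (hA : maximally_monotone dot A)
    (hzero : exists z : X, is_zero A z)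
    (x0 : X) (lam : nat -> R) (hlam : forall n : nat, 0 < lam n)
    (hinf : 0 < inf (range lam))
    (Z : set X) (hZ : submod_closed (mem Z))
    (nu : R) (hnu : 0 <= nu) :
  (exists x y eta : nat -> X,
     satisfies_algorithm A Z nu lam x0 x y eta /\ forall n : nat, eta n = 0) /\
  (0 < nu -> Z <> [set 0] ->
   exists x y eta : nat -> X,
     satisfies_algorithm A Z nu lam x0 x y eta /\
     forall n : nat, ~ is_zero A (x n) -> eta n <> 0) /\
  forall (n : nat) (xn : X),
    (is_zero A xn \/ nu = 0 \/ (~ is_zero A xn /\ 0 < nu)) /\
    (is_zero A xn -> stepS A Z nu (lam n) xn xn 0) /\
    (nu = 0 ->
     exists p : X * X,
       unique (fun q : X * X => Z q.1 /\ stepS A Z nu (lam n) xn q.2 q.1) p /\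
       p.1 = 0 /\ resolvent A (lam n) xn = [set p.2]) /\
    (~ is_zero A xn -> 0 < nu ->
     exists2 r : R, 0 < r &
       forall eta : X, Z eta -> `|eta| < r ->
       exists y : X,
         unique (fun y' : X => stepS A Z nu (lam n) xn y' eta) y /\
         resolvent A (lam n) (xn + eta) = [set y]).
Proof.
have Z0 : Z 0 by have [] := hZ; rewrite inE.
have ZZ a z : Z z -> Z (a *: z).
  have [_ Zlin] := hZ; move=> Zz; have := Zlin a z 0.
  by rewrite !inE addr0; exact.
have step0 n x := exact_step _ hdot _ hA hzero Z nu (lam n) x hnu (hlam n) Z0.
split; [|split=> [nu0 Zn0|n xn]].
- apply: (algorithm_of_steps A Z nu lam x0 (fun _ eta => eta = 0)) => n x.
  by have [y _ Sy] := step0 n x; exists y, 0.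
- have [z Zz z0] : exists2 z, Z z & z != 0.
    apply: contra_notP Zn0 => nz; apply/seteqP; split=> [z Zz /=|_ -> //].
    by apply/eqP/negP => /negP z0; apply: nz; exists z.
  apply: (algorithm_of_steps A Z nu lam x0
    (fun x eta => ~ is_zero A x -> eta <> 0)) => n x.
  (* At a zero of [A] the exact step is taken; elsewhere a nonzero [z] of [Z] is rescaled to norm
     [r / 2], inside the admissible ball. *)
  have [Ax|nAx] := pselect (is_zero A x).
    by have [y _ Sy] := step0 n x; exists y, 0.
  have [r r0 hr] := inexact_step _ hdot _ hA hzero Z nu (lam n) x nu0 (hlam n) nAx.
  have nz : 0 < `|z| by rewrite normr_gt0.
  have [||y _ Sy] := hr ((r / 2 / `|z|) *: z); first exact: ZZ.
    rewrite normrZ ger0_norm ?divr_ge0 ?ltW // ?divr_gt0 // divfK ?gt_eqF //.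
    by lra.
  exists y, ((r / 2 / `|z|) *: z); split => // _ /eqP.
  by rewrite scaler_eq0 (negbTE z0) orbF gt_eqF // !divr_gt0.
- split; [|split; [|split]].
  + have [|nAx] := pselect (is_zero A xn); first by left.
    by right; move: hnu; rewrite le_eqVlt => /predU1P[<-|]; [left|right].
  + move=> Ax; apply/stepSE; rewrite addr0 subrr !normr0 mulr0; split=> //.
    exact/resolvent_fixed.
  + move=> nu0; have [y xy Sy] := step0 n xn.
    exists (0, y); split; last first.
      by split=> //; exact: resolvent_set1 hdot _ hA _ _ _ (hlam n) xy.
    split=> // -[eta y'] [/= _ Sy'].
    (* The error bound with [nu = 0] leaves only the exact step, so uniqueness of the pair reduces
       to that of [y]. *)
    have eta0 : eta = 0.
      by have [_] := Sy'; rewrite nu0 mul0r normr_le0 => /eqP.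
    rewrite eta0 in Sy' *; congr (_, _).
    exact: (stepS_unique _ hdot _ hA _ _ _ _ _ _ (hlam n) Sy).2.
  + move=> nAx nu0.
    have [r r0 hr] := inexact_step _ hdot _ hA hzero Z nu (lam n) xn nu0 (hlam n) nAx.
    exists r => // eta Zeta etar; have [y xy Sy] := hr eta Zeta etar.
    exists y; split; last exact: resolvent_set1 hdot _ hA _ _ _ (hlam n) xy.
    exact: stepS_unique hdot _ hA _ _ _ _ _ _ (hlam n) Sy.
Qed.
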